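(* Let $m\ge 1$ and let the coupling-iteration increments $\delta^{(m)}p_h\in W_h$, $\delta^{(m)}\mathbf z_h\in\mathbf V_h$, $\delta^{(m)}\mathbf u_H\in\mathbf U_H$ satisfy, for all $\theta_h\in W_h$, $\mathbf v_h\in\mathbf V_h$, $\mathbf q_H\in\mathbf U_H$, $$\sum_{E^f\in\mathscr T_h^f}\varphi_{E^f}(\delta^{(m)}p_h,\theta_h)_{E^f}+\sum_{E^f\in\mathscr T_h^f}\Delta t(\nabla\cdot\delta^{(m)}\mathbf z_h,\theta_h)_{E^f}=-\sum_{E^f\in\mathscr T_h^f}\frac{\alpha_{E^f}}{\eta_{E^f}}(\delta^{(m-1)}\bar\sigma,\theta_h)_{E^f},$$ $$\sum_{E^f\in\mathscr T_h^f}(\boldsymbol\kappa_{E^f}^{-1}\delta^{(m)}\mathbf z_h,\mathbf v_h)_{E^f}=\sum_{E^f\in\mathscr T_h^f}(\delta^{(m)}p_h,\nabla\cdot\mathbf v_h)_{E^f},$$ $$\sum_{E^p\in\mathscr T_H^p}2G_{E^p}(\boldsymbol e(\delta^{(m)}\mathbf u_H),\boldsymbol e(\mathbf q_H))_{E^p}+\sum_{E^p\in\mathscr T_H^p}(\delta^{(m)}\sigma_v,\nabla\cdot\mathbf q_H)_{E^p}=0,$$ where $\delta^{(m)}\bar\epsilon_H=\nabla\cdot\delta^{(m)}\mathbf u_H$; on each $E^p\in\mathscr T_H^p$, $\delta^{(m)}\sigma_v=K_{b_{E^p}}\delta^{(m)}\bar\epsilon_H-\alpha_{E^p}\mathscr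 R\delta^{(m)}p_h$; and on each $E^f\in\mathscr T_h^f$, for $k\in\{m-1,m\}$, $\delta^{(k)}\bar\sigma=\eta_{E^f}\mathscr P\delta^{(k)}\bar\epsilon_H-\alpha_{E^f}\delta^{(k)}p_h$. Suppose that the following three conditions hold: 1. $\displaystyle\sum_{E^f\in\mathscr T_h^f}\alpha_{E^f}(\mathscr P\delta^{(m)}\bar\epsilon_H,\delta^{(m)}p_h)_{E^f}-\sum_{E^p\in\mathscr T_H^p}\alpha_{E^p}(\delta^{(m)}\bar\epsilon_H,\mathscr R\delta^{(m)}p_h)_{E^p}=0$; 2. $\displaystyle\sum_{E^p\in\mathscr T_H^p}\eta_{E^p}\Vert\delta^{(m)}\bar\epsilon_H\Vert^2_{E^p}-\sum_{E^f\in\mathscr T_h^f}\eta_{E^f}\Vert\mathscr P\delta^{(m)}\bar\epsilon_H\Vert^2_{E^f}\ge 0$; 3. $\eta_{E^p}\le 2K_{b_{E^p}}$ for all $E^p\in\mathscr T_H^p$. Then the two-grid staggered scheme is a contraction with constant $$\gamma=\max_{E^f\in\mathscr T_h^f}\Bigg(\frac{\alpha_{E^f}^2}{\frac{\eta_{E^f}}{M_{E^f}}+\alpha_{E^f}^2}\Bigg)<1,$$ in the sense that $$\sum_{E^f\in\mathscr T_h^f}\frac{\Vert\delta^{(m)}\bar\sigma\Vert^2_{E^f}}{\eta_{E^f}}+\sum_{E^p\in\mathscr T_H^p}4G_{E^p}\Vert\boldsymbol e(\delta^{(m)}\mathbf u_H)\Vert^2_{E^p}+\sum_{E^p\in\mathscr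 T_H^p}(2K_{b_{E^p}}-\eta_{E^p})\Vert\delta^{(m)}\bar\epsilon_H\Vert^2_{E^p}+\sum_{E^f\in\mathscr T_h^f}2\Delta t\Vert\boldsymbol\kappa_{E^f}^{-1/2}\delta^{(m)}\mathbf z_h\Vert^2_{E^f}\le\gamma\sum_{E^f\in\mathscr T_h^f}\frac{\Vert\delta^{(m-1)}\bar\sigma\Vert^2_{E^f}}{\eta_{E^f}},$$ where the second, third and fourth sums on the left-hand side are nonnegative.
   Context: Setting: $\Omega\subset\mathbb R^3$ is a bounded convex domain. $\mathscr T_h^f$ (fine flow grid) and $\mathscr T_H^p$ (coarse poromechanics grid) are finite partitions of $\Omega$ into brick elements $E^f$ and $E^p$ respectively, and they are nested: each $E^p\in\mathscr T_H^p$ is the union of the fine elements in $\mathcal I^{E^p}=\{E^f\in\mathscr T_h^f: E^f\subset E^p\}$, and each $E^f$ belongs to exactly one $\mathcal I^{E^p}$. For an element $E$, $(\cdot,\cdot)_E$ and $\Vert\cdot\Vert_E$ are the $L^2(E)$ inner product and norm (for scalar, vector or tensor fields). Material parameters are constant on elements; the subscript $E^f$ or $E^p$ denotes the value on that fine or coarse element: $\alpha$ (Biot constant), $M>0$ (Biot modulus), $K_b>0$ (drained bulk modulus), $G>0$ (shear modulus), $\boldsymbol\kappa$ (symmetric positive definite $3\times3$ hydraulic conductivity tensor), and $\eta>0$ (adjustable parameter). Fine-grid and coarse-grid values are a priori separate data. $\varphi_{E^f}=\frac1{M_{E^f}}+\frac{\alpha_{E^f}^2}{\eta_{E^f}}$.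 $\Delta t>0$ is the time step. Spaces ($\mathbb P_0$ = constants, $\mathbb Q_1$ = trilinears; $\Gamma_N^f$ and $\Gamma_D^p$ are the given parts of $\partial\Omega$ carrying the flow Neumann and the displacement Dirichlet conditions; $\mathbf n$ is the unit outward normal): $W_h=\{\theta_h:\theta_h|_{E^f}\in\mathbb P_0(E^f)\ \forall E^f\in\mathscr T_h^f\}$; $W_H=\{\theta_H:\theta_H|_{E^p}\in\mathbb P_0(E^p)\ \forall E^p\in\mathscr T_H^p\}$; $\mathbf V_h$ is a finite-dimensional mixed finite element subspace of $\mathbf H(\mathrm{div},\Omega)$ on $\mathscr T_h^f$, whose elements are on each $E^f$ the images of vector fields in a fixed finite-dimensional space $\hat{\mathbf V}(\hat E)$ on the reference brick $\hat E$, and satisfy $\mathbf v_h\cdot\mathbf n=0$ on $\Gamma_N^f$; $\mathbf U_H$ is the conforming (contained in $H^1(\Omega)^3$) space of vector fields $\mathbf q_H=(u,v,w)$ with $u|_{E^p},v|_{E^p},w|_{E^p}\in\mathbb Q_1(E^p)$ for all $E^p\in\mathscr T_H^p$ and $\mathbf q_H=\mathbf 0$ on $\Gamma_D^p$. For a displacement $\mathbf q$, $\boldsymbol e(\mathbf q)=\frac12(\nabla\mathbf q+\nabla^T\mathbf q)-\frac13(\nabla\cdot\mathbf q)\mathbf I$ is the deviatoric strain. The restriction operator $\mathscr R:W_h\to W_H$ and the prolongation operator $\mathscr P:\nabla\cdot\mathbf U_H\to W_h$ are linear maps. Scheme: at each time level and each coupling iteration the flow problem is first solved on the fine grid (pressure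 $p_h$, flux $\mathbf z_h$) with the stress measure $\bar\sigma=\eta\bar\epsilon-\alpha p$ frozen at its value from the previous coupling iteration, and then the poromechanics problem is solved on the coarse grid (displacement $\mathbf u_H$, volumetric strain $\bar\epsilon_H=\nabla\cdot\mathbf u_H$). $\delta^{(m)}(\cdot)$ denotes the change of a quantity over the $(m+1)$-th coupling iteration at a fixed time level, i.e. the value at iteration $m+1$ minus the value at iteration $m$; the increments satisfy the variational equations displayed in the claim. $\sigma_v=K_b\bar\epsilon-\alpha p$ is the mean stress. *)

(* Defs.v *)
From HB Require Import structures.
From mathcomp Require Import all_boot all_order all_algebra.
From mathcomp Require Import all_classical all_reals all_analysis.
Import Order.TTheory GRing.Theory Num.Theory.
Import numFieldNormedType.Exports.
Set Implicit Arguments.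
Unset Strict Implicit.
Unset Printing Implicit Defensive.
Local Open Scope classical_set_scope.
Local Open Scope ring_scope.

(* Points and vectors of R^3 are column vectors 'cV[R]_3.  Lebesgue measure   *)
(* lives on R * R * R and is transported along pt.                            *)

Definition pt (R : realType) (t : R * R * R) : 'cV[R]_3 :=
  \col_(i < 3) [:: t.1.1; t.1.2; t.2]`_i.

Definition leb3 (R : realType) :=
  (((@lebesgue_measure R) \x (@lebesgue_measure R)) \x (@lebesgue_measure R))%E.

Definition int3 (R : realType) (A : set 'cV[R]_3) (f : 'cV[R]_3 -> R) : R :=
  \int[@leb3 R]_(t in @pt R @^-1` A) f (pt t).

Definition eq_ae (R : realType) (T : Type) (A : set 'cV[R]_3)
    (f g : 'cV[R]_3 -> T) : Prop :=
  (@leb3 R).-negligible (@pt R @^-1` (A `&` [set x | f x <> g x])).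

(* Functions stand for their L^2 classes; only their values on A matter.      *)
Definition L2 (R : realType) (A : set 'cV[R]_3) (f : 'cV[R]_3 -> R) : Prop :=
  (f \_ A) \o @pt R \in Lfun (@leb3 R) 2%:E.

Definition L2mx (R : realType) (m n : nat) (A : set 'cV[R]_3)
    (F : 'cV[R]_3 -> 'M[R]_(m, n)) : Prop :=
  forall i j, L2 A (fun x => F x i j).

Definition mxdot (R : realType) (m n : nat) (A B : 'M[R]_(m, n)) : R :=
  \sum_i \sum_j A i j * B i j.

Definition ip (R : realType) (E : set 'cV[R]_3) (f g : 'cV[R]_3 -> R) : R :=
  int3 E (fun x => f x * g x).

Definition norm2 (R : realType) (E : set 'cV[R]_3) (f : 'cV[R]_3 -> R) : R :=
  Num.sqrt (ip E f f).

Definition ipmx (R : realType) (m n : nat) (E : set 'cV[R]_3)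
    (F G : 'cV[R]_3 -> 'M[R]_(m, n)) : R :=
  int3 E (fun x => mxdot (F x) (G x)).

Definition norm2mx (R : realType) (m n : nat) (E : set 'cV[R]_3)
    (F : 'cV[R]_3 -> 'M[R]_(m, n)) : R :=
  Num.sqrt (ipmx E F F).

Definition partial (R : realType) (j : 'I_3) (f : 'cV[R]_3 -> R) :
    'cV[R]_3 -> R :=
  fun x => 'D_(delta_mx j 0) f x.

Definition smooth (R : realType) (f : 'cV[R]_3 -> R) : Prop :=
  forall s : seq 'I_3, let g := foldr (@partial R) f s in
    continuous g /\ forall j x, derivable g x (delta_mx j 0).

Definition grad (R : realType) (f : 'cV[R]_3 -> R) : 'cV[R]_3 -> 'cV[R]_3 :=
  fun x => \col_j partial j f x.

Definition test_function (R : realType) (Omega : set 'cV[R]_3)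
    (phi : 'cV[R]_3 -> R) : Prop :=
  let supp := closure [set x | phi x != 0] in
  [/\ smooth phi, compact supp & supp `<=` Omega].

Definition is_weak_partial (R : realType) (Omega : set 'cV[R]_3) (j : 'I_3)
    (f g : 'cV[R]_3 -> R) : Prop :=
  forall phi, test_function Omega phi ->
    int3 Omega (fun x => f x * partial j phi x) =
    - int3 Omega (fun x => g x * phi x).

Definition is_weak_grad (R : realType) (Omega : set 'cV[R]_3)
    (u : 'cV[R]_3 -> 'cV[R]_3) (D : 'cV[R]_3 -> 'M[R]_3) : Prop :=
  L2mx Omega D /\ forall i j,
    is_weak_partial Omega j (fun x => u x i 0) (fun x => D x i j).

(* H^1(Omega)^3 *)
Definition H1 (R : realType) (Omega : set 'cV[R]_3)
    (u : 'cV[R]_3 -> 'cV[R]_3) : Prop :=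
  L2mx Omega u /\ exists D, is_weak_grad Omega u D.

(* A representative of the weak gradient, which is unique almost everywhere.  *)
Definition wgrad (R : realType) (Omega : set 'cV[R]_3)
    (u : 'cV[R]_3 -> 'cV[R]_3) : 'cV[R]_3 -> 'M[R]_3 :=
  get (is_weak_grad Omega u).

Definition divH1 (R : realType) (Omega : set 'cV[R]_3)
    (u : 'cV[R]_3 -> 'cV[R]_3) : 'cV[R]_3 -> R :=
  fun x => \tr (wgrad Omega u x).

Definition dev_strain (R : realType) (Omega : set 'cV[R]_3)
    (u : 'cV[R]_3 -> 'cV[R]_3) : 'cV[R]_3 -> 'M[R]_3 :=
  fun x => 2^-1 *: (wgrad Omega u x + (wgrad Omega u x)^T)
           - (3^-1 * divH1 Omega u x)%:M.

Definition is_weak_div (R : realType) (Omega : set 'cV[R]_3)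
    (v : 'cV[R]_3 -> 'cV[R]_3) (d : 'cV[R]_3 -> R) : Prop :=
  L2 Omega d /\ forall phi, test_function Omega phi ->
    int3 Omega (fun x => mxdot (v x) (grad phi x)) =
    - int3 Omega (fun x => d x * phi x).

(* H(div, Omega) *)
Definition Hdiv (R : realType) (Omega : set 'cV[R]_3)
    (v : 'cV[R]_3 -> 'cV[R]_3) : Prop :=
  L2mx Omega v /\ exists d, is_weak_div Omega v d.

(* A representative of the weak divergence, unique almost everywhere.         *)
Definition wdiv (R : realType) (Omega : set 'cV[R]_3)
    (v : 'cV[R]_3 -> 'cV[R]_3) : 'cV[R]_3 -> R :=
  get (is_weak_div Omega v).

Definition boundary (R : realType) (Omega : set 'cV[R]_3) : set 'cV[R]_3 :=
  closure Omega `\` Omega°.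

(* v . n = 0 on Gamma for v in H(div, Omega).  By Green's formula the left    *)
(* side is the boundary integral of (v . n) phi; phi vanishes on the part of  *)
(* the boundary outside Gamma.                                                *)
Definition zero_normal_trace (R : realType) (Omega Gamma : set 'cV[R]_3)
    (v : 'cV[R]_3 -> 'cV[R]_3) : Prop :=
  forall phi, smooth phi ->
    (forall x, (boundary Omega `\` Gamma) x -> phi x = 0) ->
    int3 Omega (fun x => mxdot (v x) (grad phi x)) +
    int3 Omega (fun x => wdiv Omega v x * phi x) = 0.

(* A brick is the image of the reference brick ]0, 1[^3 under the affine map  *)
(* brick_map; the columns of bedges are its (pairwise orthogonal) edges.      *)
Record brick (R : realType) := Brick {
  borigin : 'cV[R]_3;
  bedges : 'M[R]_3 }.

Definition is_brick (R : realType) (E : brick R) : Prop :=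
  is_diag_mx ((bedges E)^T *m bedges E) /\ bedges E \in unitmx.

Definition brick_map (R : realType) (E : brick R) (x : 'cV[R]_3) : 'cV[R]_3 :=
  borigin E + bedges E *m x.

Definition ref_brick (R : realType) : set 'cV[R]_3 :=
  [set x | forall i, 0 < x i 0 < 1].

Definition ref_cbrick (R : realType) : set 'cV[R]_3 :=
  [set x | forall i, 0 <= x i 0 <= 1].

Record mesh (R : realType) := Mesh {
  nelt : nat;
  elt_brick : 'I_nelt -> brick R }.

(* The open element, over which the L^2 products are taken, and its closure.  *)
Definition elt (R : realType) (T : mesh R) (i : 'I_(nelt T)) : set 'cV[R]_3 :=
  brick_map (elt_brick i) @` @ref_brick R.

Definition celt (R : realType) (T : mesh R) (i : 'I_(nelt T)) :
    set 'cV[R]_3 :=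
  brick_map (elt_brick i) @` @ref_cbrick R.

Definition brick_partition (R : realType) (Omega : set 'cV[R]_3) (T : mesh R) :
    Prop :=
  [/\ forall i : 'I_(nelt T), is_brick (elt_brick i),
      forall i : 'I_(nelt T), elt i `<=` Omega,
      forall i j : 'I_(nelt T), i != j -> elt i `&` elt j = set0 &
      closure Omega = \bigcup_(i in [set: 'I_(nelt T)]) celt i].

Definition children (R : realType) (Tf Tp : mesh R) (p : 'I_(nelt Tp)) :
    set 'I_(nelt Tf) :=
  [set f | celt f `<=` celt p].
Arguments children {R} Tf Tp p.

Definition nested (R : realType) (Tf Tp : mesh R) : Prop :=
  (forall p : 'I_(nelt Tp), celt p = \bigcup_(f in children Tf Tp p) celt f) /\
  (forall f : 'I_(nelt Tf), exists! p : 'I_(nelt Tp), children Tf Tp p f).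

(* W_h and W_H *)
Definition P0_space (R : realType) (T : mesh R) : set ('cV[R]_3 -> R) :=
  [set theta | forall i : 'I_(nelt T),
     exists c, forall x, elt i x -> theta x = c].

Definition trilinear (R : realType) (f : 'cV[R]_3 -> R) : Prop :=
  exists c : {set 'I_3} -> R,
    forall x, f x = \sum_(S : {set 'I_3}) c S * \prod_(i in S) x i 0.

(* U_H.  An H^1 field that is trilinear on each element has a representative  *)
(* continuous on the closure of Omega: this is the representative used here,  *)
(* hence the closed elements and the pointwise boundary condition.            *)
Definition Q1_space (R : realType) (Omega GammaD : set 'cV[R]_3)
    (T : mesh R) : set ('cV[R]_3 -> 'cV[R]_3) :=
  [set q | [/\ H1 Omega q,
     forall (e : 'I_(nelt T)) (i : 'I_3),
       exists2 f, trilinear f &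
         forall x, @ref_cbrick R x -> q (brick_map (elt_brick e) x) i 0 = f x &
     forall x, GammaD x -> q x = 0]].

(* v is on the open brick E the image (Piola transform) of w.                 *)
Definition piola_image (R : realType) (E : brick R)
    (w v : 'cV[R]_3 -> 'cV[R]_3) : Prop :=
  forall x, @ref_brick R x ->
    v (brick_map E x) = (\det (bedges E))^-1 *: (bedges E *m w x).

(* V is a finite-dimensional subspace of H(div, Omega); the space of fields   *)
(* on the reference brick is the span of the family Vhat.                     *)
Definition mixed_fe_space (R : realType) (Omega GammaN : set 'cV[R]_3)
    (T : mesh R) (d : nat) (Vhat : 'I_d -> 'cV[R]_3 -> 'cV[R]_3)
    (V : set ('cV[R]_3 -> 'cV[R]_3)) : Prop :=
  [/\ V (fun=> 0) /\
        (forall a v w, V v -> V w -> V (fun x => a *: v x + w x)),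
      exists n (b : 'I_n -> 'cV[R]_3 -> 'cV[R]_3), forall v, V v ->
        exists c : 'I_n -> R, eq_ae Omega v (fun x => \sum_k c k *: b k x),
      forall v, V v -> Hdiv Omega v,
      forall v, V v -> forall e : 'I_(nelt T), exists c : 'I_d -> R,
        piola_image (elt_brick e) (fun x => \sum_k c k *: Vhat k x) v &
      forall v, V v -> zero_normal_trace Omega GammaN v].

(* The space of divergences of the fields of U, closed under a.e. equality.   *)
Definition div_space (R : realType) (Omega : set 'cV[R]_3)
    (U : set ('cV[R]_3 -> 'cV[R]_3)) : set ('cV[R]_3 -> R) :=
  [set d | exists2 q, U q & eq_ae Omega d (divH1 Omega q)].

(* L is a linear map from D to C, as spaces of classes of functions modulo    *)
(* equality almost everywhere on Omega.                                       *)
Definition linear_map (R : realType) (Omega : set 'cV[R]_3)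
    (D C : set ('cV[R]_3 -> R)) (L : ('cV[R]_3 -> R) -> 'cV[R]_3 -> R) :
    Prop :=
  [/\ forall f, D f -> C (L f),
      forall f g, D f -> D g -> eq_ae Omega f g -> eq_ae Omega (L f) (L g) &
      forall a f g, D f -> D g ->
        eq_ae Omega (L (fun x => a * f x + g x))
                    (fun x => a * L f x + L g x)].

Definition spd (R : realType) (n : nat) (K : 'M[R]_n) : Prop :=
  K^T = K /\ forall x : 'cV[R]_n, x != 0 -> 0 < (x^T *m K *m x) 0 0.

(* K^(-1/2), for K symmetric positive definite *)
Definition invsqrtmx (R : realType) (n : nat) (K : 'M[R]_n) : 'M[R]_n :=
  get [set B | spd B /\ B *m B = invmx K].

(* delta^(k) s *)
Definition increment (V : zmodType) (s : nat -> V) (k : nat) : V :=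
  s k.+1 - s k.

(* K^(-1/2) exists, through the complex spectral theorem.                     *)

From mathcomp Require Import spectral complex.

Lemma interp_poly (F : fieldType) (f : F -> F) (s : seq F) :
  exists q : {poly F}, forall x, x \in s -> q.[x] = f x.
Proof.
elim: s => [|a s [q IH]]; first by exists 0.
have [as_|nas] := boolP (a \in s).
  by exists q => x; rewrite inE => /orP[/eqP->|]; exact: IH.
pose w := \prod_(y <- s) ('X - y%:P).
have wa : w.[a] != 0 by rewrite -/(root w a) root_prod_XsubC.
exists (q + ((f a - q.[a]) / w.[a]) *: w) => x; rewrite inE hornerD hornerZ.
move=> /orP[/eqP->|xs]; first by rewrite divfK// addrC subrK.
rewrite IH//; have /eqP-> : w.[x] == 0 by rewrite -/(root w x) root_prod_XsubC.
by rewrite mulr0 addr0.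
Qed.

Lemma mulmx_horner_eigen (F : fieldType) n (A : 'M[F]_n.+1) (v : 'rV_n.+1) a p :
  v *m A = a *: v -> v *m horner_mx A p = p.[a] *: v.
Proof.
move=> vA; elim/poly_ind: p => [|p c IH].
  by rewrite rmorph0 mulmx0 horner0 scale0r.
rewrite rmorphD rmorphM /= horner_mx_X horner_mx_C hornerMXaddC mulmxDr.
by rewrite mulmxA IH -scalemxAl vA scalerA mul_mx_scalar scalerDl.
Qed.

Lemma trmx_horner_sym (F : fieldType) n (A : 'M[F]_n.+1) p :
  A^T = A -> (horner_mx A p)^T = horner_mx A p.
Proof.
move=> AT; elim/poly_ind: p => [|p c IH]; first by rewrite rmorph0 trmx0.
rewrite rmorphD rmorphM /= horner_mx_X horner_mx_C linearD /= tr_scalar_mx.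
congr (_ + _); rewrite -mulmxE trmx_mul AT IH.
exact: (comm_mx_horner p (comm_mx_refl A)).
Qed.

Lemma cV_dot_gt0 (R : realType) n (x : 'cV[R]_n) : x != 0 -> 0 < (x^T *m x) 0 0.
Proof.
move=> x0; have [i xi] : exists i, x i 0 != 0.
  apply/existsP; rewrite -negb_forall; apply: contra x0 => /forallP h.
  by apply/eqP/matrixP => i j; rewrite ord1 mxE; apply/eqP.
rewrite mxE (bigD1 i)//= mxE ltr_pwDl//.
  by rewrite -expr2 exprn_even_gt0.
by apply: sumr_ge0 => j _; rewrite mxE -expr2 sqr_ge0.
Qed.

Lemma spd_unit (R : realType) n (K : 'M[R]_n) : spd K -> K \in unitmx.
Proof.
move=> [KT Kp]; rewrite -row_free_unit -kermx_eq0; apply/negPn/negP => k0.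
have /rowV0Pn[v /sub_kermxP vK v0] := k0.
have vT0 : v^T != 0 by rewrite -trmx0 (inj_eq trmx_inj).
by have := Kp _ vT0; rewrite trmxK vK mul0mx mxE ltxx.
Qed.

Lemma spd_inv (R : realType) n (K : 'M[R]_n) : spd K -> spd (invmx K).
Proof.
move=> sK; have Ku := spd_unit sK; case: sK => KT Kp.
have iT : (invmx K)^T = invmx K by rewrite trmx_inv KT.
split=> // x x0; have y0 : invmx K *m x != 0.
  by apply: contra x0 => /eqP h; rewrite -[x](mulKVmx Ku) h mulmx0.
have := Kp _ y0; rewrite trmx_mul iT -!mulmxA mulKVmx//.
Qed.

Lemma spd_eigenvalue_gt0 (R : realType) n (K : 'M[R]_n) a : spd K -> eigenvalue K a -> 0 < a.
Proof.
move=> [KT Kp] /eigenvalueP[v vK v0].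
have vT0 : v^T != 0 by rewrite -trmx0 (inj_eq trmx_inj).
have := Kp _ vT0; rewrite trmxK vK -scalemxAl mxE pmulr_lgt0//.
by have := cV_dot_gt0 vT0; rewrite trmxK.
Qed.

Lemma spd_sqrt (R : realType) n (K : 'M[R]_n.+1) : spd K ->
  exists B, spd B /\ B *m B = K.
Proof.
move=> sK; have [KT Kp] := sK.
pose iota := real_complex R.
pose A := map_mx iota K.
have Asym : A \is symmetricmx.
  by apply/is_hermitianmxP; rewrite expr0 scale1r; apply/matrixP => i j; rewrite !mxE -{1}KT mxE.
have Areal : A \is a realmx.
  apply/mxOverP => i j; rewrite mxE.
  by rewrite complex_real.
have Aherm := realsym_hermsym Asym Areal.
have /orthomx_spectralP AE := hermitian_normalmx Aherm.
have dreal := hermitian_spectral_diag_real Aherm.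
set P := spectralmx A in AE; set D := spectral_diag A in AE dreal.
have Pu : P \in unitmx by exact: spectral_unit.
have rowA i : row i P *m A = D 0 i *: row i P.
  rewrite -row_mul AE -mulmxA mulKVmx// row_mul row_diag_mx -scalemxAl.
  by rewrite rowE.
have [q qE] := interp_poly (fun x : R => Num.sqrt (Num.sqrt x))
   [seq complex.Re (D 0 i) | i : 'I_n.+1].
have DE i : D 0 i = iota (complex.Re (D 0 i)).
  have /mxOverP/(_ 0 i) := dreal.
  by move=> /RRe_real <-.
have Dpos i : 0 < complex.Re (D 0 i).
  apply: (spd_eigenvalue_gt0 sK); rewrite eigenvalue_root_char.
  suff : root (map_poly iota (char_poly K)) (iota (complex.Re (D 0 i))).
    by rewrite fmorph_root.
  rewrite -DE map_char_poly -eigenvalue_root_char.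
  apply/eigenvalueP; exists (row i P) => //.
  apply/negP => /eqP ri0; have PQ := mulmxV Pu.
  have : row i (1%:M : 'M[complex.complex R]_n.+1) = 0.
    by rewrite -PQ row_mul ri0 mul0mx.
  by move=> /rowP/(_ i); rewrite !mxE eqxx => /eqP; rewrite oner_eq0.
pose S := horner_mx K q.
have ST : S^T = S by exact: trmx_horner_sym.
have S4 : S *m S *m (S *m S) = K.
  rewrite -[RHS](horner_mx_X K) /S !mulmxE -!rmorphM.
  pose p := q * q * (q * q) - 'X.
  apply/eqP; rewrite -subr_eq0 -rmorphB -/p; apply/eqP.
  apply: (map_mx_inj (f := iota)); rewrite map_horner_mx map_mx0 -/A.
  apply: (can_inj (mulKmx Pu)); rewrite mulmx0.
  apply/row_matrixP => i; rewrite row_mul (mulmx_horner_eigen _ (rowA i)) DE.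
  have px : p.[complex.Re (D 0 i)] = 0.
    rewrite /p hornerD hornerN hornerX !hornerM qE; last exact: map_f (mem_enum _ i).
    by rewrite -!expr2 !sqr_sqrtr ?sqrtr_ge0 ?ltW// subrr.
  have -> : (map_poly iota p).[iota (complex.Re (D 0 i))] = 0; last first.
    by rewrite scale0r row0.
  by transitivity (iota p.[complex.Re (D 0 i)]);
    [exact: horner_map | rewrite px; exact: (rmorph0 (real_complex R))].
exists (S *m S); split=> //; split; first by rewrite trmx_mul ST.
move=> x x0; have Sx : S *m x != 0.
  apply: contra x0 => /eqP h; apply/eqP.
  rewrite -[x](mulKmx (spd_unit sK)) -S4 -!mulmxA h !mulmx0.
  by [].
by have := cV_dot_gt0 Sx; rewrite trmx_mul ST !mulmxA.
Qed.

Lemma invsqrtmxP (R : realType) n (K : 'M[R]_n.+1) : spd K ->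
  spd (invsqrtmx K) /\ invsqrtmx K *m invsqrtmx K = invmx K.
Proof.
move=> sK; have [B hB] := spd_sqrt (spd_inv sK).
by apply: (@getPex _ [set B | spd B /\ B *m B = invmx K]); exists B.
Qed.

(* Main.v *)
Require Import Defs.
From mathcomp Require Import all_boot all_order all_algebra.
From mathcomp Require Import all_classical all_reals all_analysis.
From mathcomp Require Import measurable_realfun.
From mathcomp Require Import ring lra.
Import Order.TTheory GRing.Theory Num.Theory.
Import numFieldNormedType.Exports.
Local Open Scope classical_set_scope.
Local Open Scope ring_scope.

(** The contraction is an energy estimate.  Write [dp], [dz], [eps] for the
    increments of pressure, flux and volumetric strain, [s] for the increment
    of the stress measure and [s0] for its value one iteration earlier.

    Testing the mass balance with [dp] and Darcy's law with [dz] eliminates the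
    term (div dz, dp) and leaves
      sum phi |dp|^2 + dt sum |kappa^(-1/2) dz|^2 = - sum alpha/eta (s0, dp).
    Weighted by the very coefficient phi that the left side provides, Young's
    inequality ([flow_young]) bounds the right side by half of
      sum phi |dp|^2 + sum (alpha^2 / (eta^2 phi)) |s0|^2,
    and alpha^2 / (eta phi) = alpha^2 / (eta/M + alpha^2) is the local rate,
    at most gamma.  Hence
      sum phi |dp|^2 + 2 dt sum |kappa^(-1/2) dz|^2 <= gamma sum |s0|^2 / eta.

    Testing the mechanics with the displacement increment expresses the
    shear and bulk energies through the coupling term sum alpha (R dp, eps).
    The same term, as sum alpha (P eps, dp) on the fine grid by the first
    condition, is the cross term in the expansion of |s|^2 / eta.  The two
    cancel in the left side of the claim, which reduces to
      (sum eta |P eps|^2 - sum eta |eps|^2) + sum alpha^2/eta |dp|^2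
        + 2 dt sum |kappa^(-1/2) dz|^2.
    The bracket is nonpositive by the second condition, and alpha^2/eta <= phi.

    On the analytic side, [dp], [s], [P eps] are constant on fine elements, so
    that fine-grid products are numbers times volumes ([ip_cst]).  On the
    coarse grid [eps] is merely square integrable, and splitting
    (K eps - alpha R dp, eps) requires [eps] to be integrable on a brick, which
    holds because bricks have finite volume ([ip_affine]). *)

Set Implicit Arguments.
Unset Strict Implicit.

(** * Bricks and integration over them *)

Section Elements.
Context {R : realType}.
(* The reals with the sigma-algebra that carries [leb3]; it differs from the
   default one on [R * R * R] only in its display. *)
Local Notation R3 :=
  (measurableTypeR R * measurableTypeR R * measurableTypeR R)%type.
Implicit Types (E Omega : set 'cV[R]_3) (f g h : 'cV[R]_3 -> R).

Lemma measurable_pt_coord (i : 'I_3) :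
  measurable_fun setT (fun t : R3 => pt t i 0).
Proof.
case: i => -[|[|[|//]]] hi.
- rewrite (_ : (fun t => _) = fst \o fst); first exact: measurableT_comp.
  by apply/funext => t; rewrite /pt mxE.
- rewrite (_ : (fun t => _) = snd \o fst); first exact: measurableT_comp.
  by apply/funext => t; rewrite /pt mxE.
- rewrite (_ : (fun t => _) = snd) //.
  by apply/funext => t; rewrite /pt mxE.
Qed.

Lemma measurable_pt_affine (A : 'M[R]_3) (c : 'cV[R]_3) (i : 'I_3) :
  measurable_fun setT (fun t : R3 => (A *m (pt t - c)) i 0).
Proof.
rewrite (_ : (fun t => _) = fun t => \sum_j A i j * (pt t j 0 - c j 0)).
  apply: measurable_sum => j; apply: measurable_funM => //.
  by apply: measurable_funB => //; exact: measurable_pt_coord.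
by apply/funext => t; rewrite mxE; apply: eq_bigr => j _; rewrite !mxE.
Qed.

(** In the coordinates of the reference brick an element is cut out by the
    conditions 0 < x_i < 1, and these coordinates are affine, hence measurable,
    functions of the point. *)
Lemma measurable_elt (T : mesh R) (e : 'I_(nelt T)) :
  is_brick (elt_brick e) -> measurable (@pt R @^-1` elt e : set R3).
Proof.
move=> [_ Bu]; set B := bedges _ in Bu; set o := borigin (elt_brick e).
rewrite [X in measurable X](_ : _ = \bigcap_(i in [set: 'I_3])
   ((fun t => (invmx B *m (pt t - o)) i 0) @^-1` `]0, 1[)).
  apply: fin_bigcap_measurable => // i _.
  by rewrite -[X in measurable X]setTI; exact: measurable_pt_affine.
apply/seteqP; split => t /=.
  move=> [x rx xt] i _; rewrite /preimage /= in_itv /= -xt /brick_map -/B -/o.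
  by rewrite addrC addKr mulKmx//; exact: rx.
move=> h; exists (invmx B *m (pt t - o)).
  by move=> i; have := h i I; rewrite /= in_itv.
by rewrite /brick_map -/B -/o mulKVmx// addrC subrK.
Qed.

(** A brick fits in an axis-parallel box, whose volume is a product of lengths. *)
Lemma elt_volume_lty (T : mesh R) (e : 'I_(nelt T)) :
  is_brick (elt_brick e) -> (@leb3 R (@pt R @^-1` elt e) < +oo)%E.
Proof.
move=> be; set B := bedges (elt_brick e); set o := borigin (elt_brick e).
(* |x_i| <= |o_i| + sum_j |B_ij| for x = o + B y with y in the unit cube. *)
pose r i := `|o i 0| + \sum_j `|B i j|.
have xr x : elt e x -> forall i, - r i <= x i 0 <= r i.
  move=> [y ry <-] i; rewrite -ler_norml /brick_map -/B -/o !mxE.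
  rewrite (le_trans (ler_normD _ _))// lerD2l.
  rewrite (le_trans (ler_norm_sum _ _ _))//; apply: ler_sum => j _.
  rewrite normrM ler_piMr//; have /andP[y0 y1] := ry j.
  by rewrite ger0_norm ltW.
pose I i := `[- r i, r i]%classic.
have Ioo i : (lebesgue_measure (I i) < +oo)%E.
  by rewrite lebesgue_measure_itv; case: ifP => // _; rewrite -EFinB ltry.
have mI i : measurable (I i) by exact: measurable_itv.
apply: (@le_lt_trans _ _ (@leb3 R ((I 0%R `*` I 1%R) `*` I 2%:R))%E).
  apply: le_measure; rewrite ?inE.
  - exact: measurable_elt.
  - by apply: measurableX; [apply: measurableX|]; exact: mI.
  - move=> t Et; have h := xr _ Et; have := h 0; have := h 1; have := h 2%:R.
    by rewrite /pt !mxE /= /I /= !in_itv.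
have -> : (@leb3 R (I 0%R `*` I 1%R `*` I 2%:R) = lebesgue_measure (I 0%R) *
    lebesgue_measure (I 1%R) * lebesgue_measure (I 2%:R))%E.
  rewrite /leb3 product_measure1E; [|by apply: measurableX; exact: mI|exact: mI].
  congr (_ * _)%E; by apply: product_measure1E; exact: mI.
have Ifin i : (lebesgue_measure (I i) \is a fin_num)%E by rewrite ge0_fin_numE.
by rewrite -ge0_fin_numE ?mule_ge0// !fin_numM.
Qed.

Lemma eq_int3 E f g : (forall x, E x -> f x = g x) -> int3 E f = int3 E g.
Proof. by move=> fg; apply: eq_Rintegral => t; rewrite inE => Et; exact: fg. Qed.

Lemma int3_ge0 E f : (forall x, E x -> 0 <= f x) -> 0 <= int3 E f.
Proof. by move=> f0; apply: Rintegral_ge0 => t; exact: f0. Qed.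

Definition volume E : R := fine (@leb3 R (@pt R @^-1` E)).

Lemma volume_ge0 E : 0 <= volume E.
Proof. exact: fine_ge0. Qed.

Lemma int3_cst E f c : measurable (@pt R @^-1` E : set R3) ->
  (forall x, E x -> f x = c) -> int3 E f = c * volume E.
Proof. by move=> mE /eq_int3 ->; exact: Rintegral_cst. Qed.

Lemma ip_sym E f g : ip E f g = ip E g f.
Proof. by apply: eq_int3 => x _; rewrite mulrC. Qed.

Lemma sqr_norm2 E f : norm2 E f ^+ 2 = ip E f f.
Proof. by rewrite sqr_sqrtr// int3_ge0// => x _; rewrite -expr2 sqr_ge0. Qed.

Lemma mxdot_ge0 m n (A : 'M[R]_(m, n)) : 0 <= mxdot A A.
Proof. by do 2![apply: sumr_ge0 => ? _]; rewrite -expr2 sqr_ge0. Qed.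

Lemma sqr_norm2mx E m n (F : 'cV[R]_3 -> 'M[R]_(m, n)) :
  norm2mx E F ^+ 2 = ipmx E F F.
Proof. by rewrite sqr_sqrtr// int3_ge0// => x _; exact: mxdot_ge0. Qed.

Lemma mxdot_trE n (x y : 'cV[R]_n) : mxdot x y = (x^T *m y) 0 0.
Proof. by rewrite mxE; apply: eq_bigr => i _; rewrite big_ord1 mxE. Qed.

(** The square root is symmetric, so it can be moved across the product to
    form the inverse of [K]; the identity holds pointwise. *)
Lemma ipmx_invsqrtmx E (K : 'M[R]_3) (v : 'cV[R]_3 -> 'cV[R]_3) : spd K ->
  ipmx E (fun x => invsqrtmx K *m v x) (fun x => invsqrtmx K *m v x) =
  ipmx E (fun x => invmx K *m v x) v.
Proof.
move=> /invsqrtmxP[[ST _] SS]; apply: eq_int3 => x _.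
have iT : (invmx K)^T = invmx K by rewrite -SS trmx_mul ST.
by rewrite !mxdot_trE !trmx_mul ST iT -!mulmxA [in LHS](mulmxA (invsqrtmx K)) SS.
Qed.

(** * Square-integrable fields on elements *)

Lemma L2_sum Omega (I : Type) (s : seq I) (F : I -> 'cV[R]_3 -> R) :
  (forall i, L2 Omega (F i)) -> L2 Omega (fun x => \sum_(i <- s) F i x).
Proof.
move=> F2; rewrite /L2.
rewrite (_ : _ \o _ = \sum_(i <- s) ((F i \_ Omega) \o @pt R)).
  by apply: rpred_sum => [|f0 i _]; [rewrite lee1n|exact: F2].
apply/funext => t /=; rewrite /= fct_sumE /= patchE.
case: ifPn => tO; first by apply: eq_bigr => i _; rewrite patchE tO.
by rewrite big1// => i _; rewrite patchE (negbTE tO).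
Qed.

(** The chosen representative of the weak gradient is one as soon as some weak
    gradient exists, and its trace is a finite sum of L^2 entries. *)
Lemma L2_divH1 Omega u : H1 Omega u -> L2 Omega (divH1 Omega u).
Proof.
move=> [_ [D wD]]; apply: L2_sum => i.
by have [+ _] := @getPex _ (is_weak_grad Omega u) (ex_intro _ D wD); apply.
Qed.

(** On a set of finite measure L^2 is contained in L^1, by |h| <= 1 + h^2. *)
Lemma L2_integrable Omega E h : measurable (@pt R @^-1` E : set R3) ->
  (@leb3 R (@pt R @^-1` E) < +oo)%E -> E `<=` Omega -> L2 Omega h ->
  (@leb3 R).-integrable (@pt R @^-1` E) (fun t => (h (pt t))%:E) /\
  (@leb3 R).-integrable (@pt R @^-1` E) (fun t => (h (pt t) ^+ 2)%:E).
Proof.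
move=> mE Efin EO h2; pose g : R3 -> R := (h \_ Omega) \o @pt R.
have gE t : E (pt t) -> g t = h (pt t).
  by move=> /EO Ot; rewrite /g /= patchE mem_set.
have mg : measurable_fun setT g by case/andP: h2 => + _; rewrite inE.
have g2 : (@leb3 R).-integrable (@pt R @^-1` E) (fun t => (g t ^+ 2)%:E).
  by apply: integrableS (Lfun2_integrable_sqr h2).
have h2E : (@leb3 R).-integrable (@pt R @^-1` E) (fun t => (h (pt t) ^+ 2)%:E).
  by apply: eq_integrable g2 => // t; rewrite inE => Et; rewrite gE.
split => //.
suff g1 : (@leb3 R).-integrable (@pt R @^-1` E) (fun t => (g t)%:E).
  by apply: eq_integrable g1 => // t; rewrite inE => Et; rewrite gE.
have c1 : (@leb3 R).-integrable (@pt R @^-1` E) (cst 1%:E).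
  by apply/integrableP; split => //; rewrite /= integral_cst// normr1 mul1e.
apply: (le_integrable mE _ _ (integrableD mE c1 g2)).
  by apply/measurable_EFinP; exact: measurable_funTS.
move=> t _ /=; rewrite lee_fin [leRHS]ger0_norm ?addr_ge0 ?sqr_ge0//.
by rewrite ler_norml; have := sqr_ge0 (g t - 1); have := sqr_ge0 (g t + 1); nra.
Qed.

(** Splits the mean stress [a h - b r], with [r] constant on the element, in a
    product against [h].  Integrals of arbitrary functions are not additive:
    this is where the integrability of [h] and [h^2] enters. *)
Lemma ip_affine Omega E h r (a b c : R) : measurable (@pt R @^-1` E : set R3) ->
  (@leb3 R (@pt R @^-1` E) < +oo)%E -> E `<=` Omega -> L2 Omega h ->
  (forall x, E x -> r x = c) ->
  ip E (fun x => a * h x - b * r x) h = a * ip E h h - b * ip E h r.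
Proof.
move=> mE Efin EO h2 rc.
have [i1 i2] := L2_integrable mE Efin EO h2.
have rhs : ip E h r = \int[@leb3 R]_(t in @pt R @^-1` E) (c * h (pt t)).
  by apply: eq_Rintegral => t; rewrite inE => Et; rewrite rc// mulrC.
rewrite rhs (RintegralZl c mE i1) mulrA -(RintegralZl (b * c) mE i1).
have -> : ip E h h = \int[@leb3 R]_(t in @pt R @^-1` E) (h (pt t) ^+ 2).
  by apply: eq_Rintegral => t _; rewrite expr2.
rewrite -(RintegralZl a mE i2) -RintegralB//.
- by apply: eq_Rintegral => t; rewrite inE => Et; rewrite rc//; ring.
- exact: (integrableZl mE a i2).
- exact: (integrableZl mE (b * c) i1).
Qed.

(** * Piecewise constant functions *)

Lemma P0_spaceP (T : mesh R) f : P0_space T f ->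
  exists c : 'I_(nelt T) -> R, forall e x, elt e x -> f x = c e.
Proof. by move=> fT; have [c cE] := choice fT; exists c. Qed.

Lemma ip_cst E f g a b : measurable (@pt R @^-1` E : set R3) ->
  (forall x, E x -> f x = a) -> (forall x, E x -> g x = b) ->
  ip E f g = a * b * volume E.
Proof. by move=> mE fa gb; apply: int3_cst => // x Ex; rewrite fa// gb. Qed.

Lemma eq_ae_refl Omega (f : 'cV[R]_3 -> R) : eq_ae Omega f f.
Proof.
rewrite /eq_ae (_ : _ @^-1` _ = set0); first exact: negligible_set0.
by apply/seteqP; split => // t [_ /=].
Qed.
End Elements.

(** * The local contraction rate *)

Section Rate.
Context {R : realType}.

Definition flow_rate (alpha M eta : R) : R := alpha ^+ 2 / (eta / M + alpha ^+ 2).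

Lemma flow_rate_lt1 alpha M eta : 0 < M -> 0 < eta -> flow_rate alpha M eta < 1.
Proof.
move=> M0 e0; have q0 : 0 < eta / M by rewrite divr_gt0.
by rewrite ltr_pdivrMr ?mul1r ?ltrDr// ltr_wpDr// sqr_ge0.
Qed.

(** Completing the square in [phi p + (alpha/eta) s], where
    [phi = 1/M + alpha^2/eta].  The weight [phi] is dictated by the flow
    equation, which controls exactly [phi p^2]; the coefficient left in front
    of [s^2 / eta] is then alpha^2 / (eta phi), the local rate. *)
Lemma flow_young alpha M eta p s : 0 < M -> 0 < eta ->
  - (2 * (alpha / eta * (s * p))) <=
  (M^-1 + alpha ^+ 2 / eta) * p ^+ 2 + flow_rate alpha M eta * (s ^+ 2 / eta).
Proof.
move=> M0 e0; set phi := M^-1 + _.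
have phi0 : 0 < phi by rewrite ltr_wpDr ?invr_gt0// divr_ge0 ?sqr_ge0// ltW.
have -> : flow_rate alpha M eta = alpha ^+ 2 / (eta * phi).
  by rewrite /flow_rate /phi mulrDr mulrCA mulfV ?gt_eqF// mulr1.
rewrite lerNl -subr_ge0 opprK.
have -> : 2 * (alpha / eta * (s * p)) + (phi * p ^+ 2 + alpha ^+ 2 / (eta * phi) * (s ^+ 2 / eta))
   = phi^-1 * (phi * p + alpha / eta * s) ^+ 2.
  by field; rewrite !gt_eqF.
by rewrite mulr_ge0 ?sqr_ge0// ltW// invr_gt0.
Qed.
End Rate.

(** * The contraction estimate *)

Unset Implicit Arguments.

Theorem theorem3p1 (R : realType)
  (Omega GammaN GammaD : set 'cV[R]_3) (Th TH : mesh R)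
  (d : nat) (Vhat : 'I_d -> 'cV[R]_3 -> 'cV[R]_3)
  (Vh : set ('cV[R]_3 -> 'cV[R]_3))
  (alphaf Mf etaf : 'I_(nelt Th) -> R) (kappa : 'I_(nelt Th) -> 'M[R]_3)
  (alphap Kb G etap : 'I_(nelt TH) -> R) (dt : R)
  (restr prol : ('cV[R]_3 -> R) -> 'cV[R]_3 -> R)
  (p : nat -> 'cV[R]_3 -> R) (z u : nat -> 'cV[R]_3 -> 'cV[R]_3) (m : nat) :
  let Wh := P0_space Th in
  let WH := P0_space TH in
  let UH := Q1_space Omega GammaD TH in
  let phif f := (Mf f)^-1 + alphaf f ^+ 2 / etaf f in
  let dp k := increment p k in
  let dz k := increment z k in
  let du k := increment u k in
  let deps k := divH1 Omega (du k) in
  let dsigmav (e : 'I_(nelt TH)) k :=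
    fun x => Kb e * deps k x - alphap e * restr (dp k) x in
  let dsigmab (f : 'I_(nelt Th)) k :=
    fun x => etaf f * prol (deps k) x - alphaf f * dp k x in
  let gamma := \big[Num.max/0]_(f < nelt Th)
    (alphaf f ^+ 2 / (etaf f / Mf f + alphaf f ^+ 2)) in
  Omega !=set0 -> open Omega -> bounded_set Omega -> convex_set Omega ->
  GammaN `<=` boundary Omega -> GammaD `<=` boundary Omega ->
  brick_partition Omega Th -> brick_partition Omega TH -> nested Th TH ->
  mixed_fe_space Omega GammaN Th Vhat Vh ->
  (forall f, 0 < Mf f) -> (forall f, 0 < etaf f) ->
  (forall f, spd (kappa f)) ->
  (forall e, 0 < Kb e) -> (forall e, 0 < G e) -> (forall e, 0 < etap e) ->
  0 < dt ->
  linear_map Omega Wh WH restr ->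
  linear_map Omega (div_space Omega UH) Wh prol ->
  (1 <= m)%N ->
  Wh (dp m) -> Wh (dp m.-1) -> Vh (dz m) -> UH (du m) -> UH (du m.-1) ->
  (forall theta, Wh theta ->
     \sum_f phif f * ip (elt f) (dp m) theta +
     \sum_(f < nelt Th) dt * ip (elt f) (wdiv Omega (dz m)) theta =
     - \sum_f alphaf f / etaf f * ip (elt f) (dsigmab f m.-1) theta) ->
  (forall v, Vh v ->
     \sum_f ipmx (elt f) (fun x => invmx (kappa f) *m dz m x) v =
     \sum_(f < nelt Th) ip (elt f) (dp m) (wdiv Omega v)) ->
  (forall q, UH q ->
     \sum_e 2 * G e *
       ipmx (elt e) (dev_strain Omega (du m)) (dev_strain Omega q) +
     \sum_e ip (elt e) (dsigmav e m) (divH1 Omega q) = 0) ->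
  \sum_f alphaf f * ip (elt f) (prol (deps m)) (dp m) -
  \sum_e alphap e * ip (elt e) (deps m) (restr (dp m)) = 0 ->
  0 <= \sum_e etap e * norm2 (elt e) (deps m) ^+ 2 -
       \sum_f etaf f * norm2 (elt f) (prol (deps m)) ^+ 2 ->
  (forall e, etap e <= 2 * Kb e) ->
  let S2 := \sum_e 4 * G e *
    norm2mx (elt e) (dev_strain Omega (du m)) ^+ 2 in
  let S3 := \sum_e (2 * Kb e - etap e) * norm2 (elt e) (deps m) ^+ 2 in
  let S4 := \sum_f 2 * dt *
    norm2mx (elt f) (fun x => invsqrtmx (kappa f) *m dz m x) ^+ 2 in
  gamma < 1 /\
  \sum_f norm2 (elt f) (dsigmab f m) ^+ 2 / etaf f + S2 + S3 + S4 <=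
    gamma * \sum_f norm2 (elt f) (dsigmab f m.-1) ^+ 2 / etaf f /\
  [/\ 0 <= S2, 0 <= S3 & 0 <= S4].
Proof.
move=> Wh WH UH phif dp dz du deps dsigmav dsigmab gamma.
move=> _ _ _ _ _ _ [brf _ _ _] [brp subp _ _] _ _ M0 eta0 spdk K0 G0 _ dt0.
move=> [restrW _ _] [prolW _ _] _ Wp Wp0 Vz Uu Uu0 flow darcy mech c1 c2 c3.
move=> S2 S3 S4.
have mf f := measurable_elt (brf f).
have depsD k : UH (du k) -> div_space Omega UH (deps k).
  by move=> Uk; exists (du k) => //; exact: eq_ae_refl.
have [a aE] := P0_spaceP Wp.
have [a0 a0E] := P0_spaceP Wp0.
have [b bE] := P0_spaceP (prolW _ (depsD _ Uu)).
have [b0 b0E] := P0_spaceP (prolW _ (depsD _ Uu0)).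
have [r rE] := P0_spaceP (restrW _ Wp).
pose V f := volume (elt (T := Th) f).
have V0 f : 0 <= V f by exact: volume_ge0.
pose s f := etaf f * b f - alphaf f * a f.
pose s0 f := etaf f * b0 f - alphaf f * a0 f.
have sE f x : elt f x -> dsigmab f m x = s f.
  by move=> fx; rewrite /dsigmab (aE f)// (bE f).
have s0E f x : elt f x -> dsigmab f m.-1 x = s0 f.
  by move=> fx; rewrite /dsigmab (a0E f)// (b0E f).
have gamma_lt1 : gamma < 1.
  by apply: bigmax_lt => // f _; exact: flow_rate_lt1.
have S4E : S4 = 2 * dt * \sum_(f < nelt Th) ip (elt f) (dp m) (wdiv Omega (dz m)).
  rewrite -darcy// mulr_sumr; apply: eq_bigr => f _.
  by rewrite sqr_norm2mx ipmx_invsqrtmx.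
have S2_ge0 : 0 <= S2.
  by apply: sumr_ge0 => e _; rewrite mulr_ge0 ?sqr_ge0// mulr_ge0// ltW.
have S3_ge0 : 0 <= S3.
  by apply: sumr_ge0 => e _; rewrite mulr_ge0 ?sqr_ge0// subr_ge0.
have S4_ge0 : 0 <= S4.
  by apply: sumr_ge0 => f _; rewrite mulr_ge0 ?sqr_ge0// mulr_ge0// ltW.
split=> //; split=> //.
set N := \sum_f _; set N0 := \sum_f _.
have NE : N = \sum_f s f ^+ 2 / etaf f * V f.
  apply: eq_bigr => f _; rewrite sqr_norm2 (ip_cst (mf f) (sE f) (sE f)) -/(V f).
  by ring.
have N0E : N0 = \sum_f s0 f ^+ 2 / etaf f * V f.
  apply: eq_bigr => f _; rewrite sqr_norm2 (ip_cst (mf f) (s0E f) (s0E f)) -/(V f).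
  by ring.
pose A := \sum_f phif f * a f ^+ 2 * V f.
have flow_bound : A + S4 <= gamma * N0.
  (* Test with dp; the flux term becomes the Darcy energy S4 / 2. *)
  have := flow _ Wp.
  rewrite -[X in _ + X]mulr_sumr.
  rewrite (eq_bigr (fun f => phif f * a f ^+ 2 * V f)); last first.
    by move=> f _; rewrite (ip_cst (mf f) (aE f) (aE f)) -/(V f); ring.
  rewrite [in RHS](eq_bigr (fun f => alphaf f / etaf f * (s0 f * a f) * V f)); last first.
    by move=> f _; rewrite (ip_cst (mf f) (s0E f) (aE f)) -/(V f); ring.
  rewrite -/A (eq_bigr (fun f => ip (elt f) (dp m) (wdiv Omega (dz m)))); last first.
    by move=> f _; rewrite ip_sym.
  move=> eqA.
  have young : - (2 * \sum_f alphaf f / etaf f * (s0 f * a f) * V f) <= A + gamma * N0.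
    rewrite N0E /A !mulr_sumr -sumrN -big_split /=; apply: ler_sum => f _.
    have := flow_young (alphaf f) (a f) (s0 f) (M0 f) (eta0 f).
    rewrite -/(phif f) => yf.
    have gf : flow_rate (alphaf f) (Mf f) (etaf f) <= gamma.
      exact: (le_bigmax _ (fun f => flow_rate (alphaf f) (Mf f) (etaf f))).
    have sf : 0 <= s0 f ^+ 2 / etaf f by rewrite divr_ge0 ?sqr_ge0// ltW.
    have := ler_wpM2r (V0 f) (le_trans yf (lerD (lexx _) (ler_wpM2r sf gf))).
    by rewrite mulNr !mulrDl !mulrA.
  by rewrite S4E; move: eqA young; set Z := \sum_f ip _ _ _; set Y := \sum_f _; lra.
pose C := \sum_f alphaf f * (b f * a f) * V f.
have couplE : \sum_e alphap e * ip (elt e) (deps m) (restr (dp m)) = C.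
  apply/esym/eqP; rewrite -subr_eq0 -[X in _ == X]c1; apply/eqP; congr (_ - _).
  by apply: eq_bigr => f _; rewrite (ip_cst (mf f) (bE f) (aE f)) -/(V f) !mulrA.
pose D := \sum_e Kb e * ip (elt e) (deps m) (deps m).
have mechE : S2 + 2 * D = 2 * C.
  (* Test with the displacement increment, and double. *)
  have := mech _ Uu.
  rewrite [X in _ + X](eq_bigr (fun e => Kb e * ip (elt e) (deps m) (deps m) -
    alphap e * ip (elt e) (deps m) (restr (dp m)))); last first.
    move=> e _; apply: (@ip_affine _ Omega _ _ _ _ _ (r e)) => //.
    - exact: measurable_elt.
    - exact: elt_volume_lty.
    - by apply: L2_divH1; case: Uu.
    - exact: rE.
  rewrite sumrB couplE -/D => eqC.
  have -> : S2 = 2 * \sum_e 2 * G e *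
      ipmx (elt e) (dev_strain Omega (du m)) (dev_strain Omega (du m)).
    by rewrite mulr_sumr; apply: eq_bigr => e _; rewrite sqr_norm2mx; ring.
  by move: eqC; set X := \sum_e _; lra.
pose B := \sum_f etaf f * b f ^+ 2 * V f.
pose D' := \sum_e etap e * ip (elt e) (deps m) (deps m).
have S3E : S3 = 2 * D - D'.
  rewrite mulr_sumr -sumrB; apply: eq_bigr => e _; rewrite sqr_norm2; ring.
have BD : B <= D'.
  rewrite -subr_ge0; apply: le_trans c2 _; rewrite le_eqVlt; apply/orP; left.
  apply/eqP; congr (_ - _); apply: eq_bigr => f _; rewrite sqr_norm2//.
  by rewrite (ip_cst (mf f) (bE f) (bE f)) -/(V f); ring.
have NA : N <= B - 2 * C + A.
  rewrite NE /B /C /A mulr_sumr -sumrB -big_split /=; apply: ler_sum => f _.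
  rewrite (mulrA 2) -mulrBl -mulrDl; apply: ler_wpM2r => //.
  (* phi exceeds the coefficient alpha^2/eta of a^2 in s^2/eta by 1/M. *)
  have ap : 0 <= (Mf f)^-1 * a f ^+ 2 by rewrite mulr_ge0 ?sqr_ge0// invr_ge0 ltW.
  have -> : s f ^+ 2 / etaf f = etaf f * b f ^+ 2 - 2 * (alphaf f * (b f * a f))
      + alphaf f ^+ 2 / etaf f * a f ^+ 2.
    by rewrite /s; field; rewrite gt_eqF.
  by rewrite /phif mulrDl; lra.
lra.
Qed.
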